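(* Let $(T,[-,-,-],\cdot)$ be a truss and let $P$ be a left paragon in $T$. (1) For any $e\in P$, $P$ is a left $T$-module by $$\alpha_e:T\to E(P),\qquad x\mapsto\big[p\mapsto\lambda^e(x,p)\big],\qquad\text{where }\lambda^e(x,p)=[e,xe,xp].$$ (2) For all $e,\tilde e\in P$, the modules $(P,\alpha_e)$ and $(P,\alpha_{\tilde e})$ are mutually isomorphic.
   Context: A heap is a non-empty set $H$ with a ternary operation $[-,-,-]$ satisfying $[v,w,[x,y,z]]=[[v,w,x],y,z]$ and $[x,x,y]=y=[y,x,x]$; it is Abelian if $[x,y,z]=[z,y,x]$. A heap morphism is a function preserving the ternary operations. A sub-heap is a (non-empty) subset closed under $[-,-,-]$. A truss is an Abelian heap $T$ with an associative binary operation (juxtaposition) satisfying $w[x,y,z]=[wx,wy,wz]$ and $[x,y,z]w=[xw,yw,zw]$; a truss morphism preserves both operations. A left paragon in $T$ is a sub-heap $P$ of $T$ such that $[p',xp',xp]\in P$ for all $x\in T$ and all $p,p'\in P$. For an Abelian heap $H$, $E(H)$ is the truss of all heap endomorphisms of $H$ with the pointwise heap operation and composition. A left $T$-module is an Abelian heap $M$ with a truss morphism $\alpha_M:T\to E(M)$; one writes $x\triangleright m=\alpha_M(x)(m)$. A morphism of left $T$-modules is a heap morphism $\varphi$ with $\varphi(x\triangleright m)=x\triangleright\varphi(m)$; an isomorphism is a bijective morphism. *)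

(* Defs.v *)
From HB Require Import structures.
From mathcomp Require Import all_boot boolp classical_sets.

Set Implicit Arguments.
Unset Strict Implicit.
Unset Printing Implicit Defensive.

Declare Scope truss_scope.
Delimit Scope truss_scope with truss.
Local Open Scope classical_set_scope.

HB.mixin Record isHeap (H : Type) := {
  hop : H -> H -> H -> H;
  heap_inhabited : inhabited H;
  hopA : forall v w x y z, hop v w (hop x y z) = hop (hop v w x) y z;
  hopxxy : forall x y, hop x x y = y;
  hopyxx : forall x y, hop y x x = y
}.
#[short(type="heapType")]
HB.structure Definition Heap := {H of isHeap H}.

Notation "{[ x , y , z ]}" := (hop x y z)
  (at level 0, x at level 99, y at level 99, z at level 99,
   format "{[ x ,  y ,  z ]}") : truss_scope.
Local Open Scope truss_scope.

HB.mixin Record Heap_isAbelian H of Heap H := {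
  hopC : forall x y z : H, {[x, y, z]} = {[z, y, x]}
}.
#[short(type="abHeapType")]
HB.structure Definition AbHeap := {H of Heap H & Heap_isAbelian H}.

(* The multiplication need not have a unit. *)
HB.mixin Record AbHeap_isTruss T of AbHeap T := {
  tmul : T -> T -> T;
  tmulA : forall x y z, tmul x (tmul y z) = tmul (tmul x y) z;
  tmul_hopr : forall w x y z : T,
    tmul w {[x, y, z]} = {[tmul w x, tmul w y, tmul w z]};
  tmul_hopl : forall w x y z : T,
    tmul {[x, y, z]} w = {[tmul x w, tmul y w, tmul z w]}
}.
#[short(type="trussType")]
HB.structure Definition Truss := {T of AbHeap T & AbHeap_isTruss T}.

Notation "x * y" := (tmul x y) : truss_scope.

Record heapMorphism (H K : heapType) := HeapMorphism {
  heap_fun :> H -> K;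
  heap_fun_hop : forall x y z,
    heap_fun {[x, y, z]} = {[heap_fun x, heap_fun y, heap_fun z]}
}.

Record trussMorphism (T U : trussType) := TrussMorphism {
  truss_fun :> heapMorphism T U;
  truss_fun_mul : forall x y, truss_fun (x * y) = truss_fun x * truss_fun y
}.

Record subHeap (H : heapType) := SubHeap {
  subheap_set :> set H;
  subheap_neq0 : subheap_set !=set0;
  subheap_hop : forall x y z, subheap_set x -> subheap_set y ->
    subheap_set z -> subheap_set {[x, y, z]}
}.

Record leftParagon (T : trussType) := LeftParagon {
  paragon_subheap :> subHeap T;
  paragonP : forall x p p' : T,
    subheap_set paragon_subheap p -> subheap_set paragon_subheap p' ->
    subheap_set paragon_subheap {[p', x * p', x * p]}
}.

(* The coercion [set_type] makes a sub-heap the type of its elements, which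
   carries the restricted operation. *)
Section SubHeapHeap.
Variables (H : heapType) (S : subHeap H).
Implicit Types x y z : S.

Fact sub_hop_subproof x y z : {[val x, val y, val z]} \in (S : set H).
Proof. by apply/mem_set/subheap_hop; apply: set_mem; exact: valP. Qed.

Definition sub_hop x y z : S :=
  exist _ {[val x, val y, val z]} (sub_hop_subproof x y z).

Fact sub_inhabited : inhabited S.
Proof. by have [x Sx] := subheap_neq0 S; exists; exists x; exact: mem_set. Qed.

Fact sub_hopA v w x y z :
  sub_hop v w (sub_hop x y z) = sub_hop (sub_hop v w x) y z.
Proof. by apply: val_inj; exact: hopA. Qed.

Fact sub_hopxxy x y : sub_hop x x y = y.
Proof. by apply: val_inj; exact: hopxxy. Qed.

Fact sub_hopyxx x y : sub_hop y x x = y.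
Proof. by apply: val_inj; exact: hopyxx. Qed.

HB.instance Definition _ := isHeap.Build (set_type (subheap_set S))
  sub_inhabited sub_hopA sub_hopxxy sub_hopyxx.

End SubHeapHeap.

Section SubHeapAbelian.
Variables (H : abHeapType) (S : subHeap H).

Fact sub_hopC (x y z : S) : {[x, y, z]} = {[z, y, x]}.
Proof. by apply: val_inj; exact: hopC. Qed.

HB.instance Definition _ :=
  Heap_isAbelian.Build (set_type (subheap_set S)) sub_hopC.

End SubHeapAbelian.

Section HeapTheory.

Lemma hop_mid (H : heapType) (x y z w v : H) :
  {[x, {[y, z, w]}, v]} = {[{[x, w, z]}, y, v]}.
Proof.
have e : {[{[x, w, z]}, y, {[y, z, w]}]} = x.
  by rewrite -hopA (hopA z) hopyxx hopxxy hopyxx.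
by rewrite -{1}e -hopA hopxxy.
Qed.

Lemma hop_swapr (H : abHeapType) (a b c d e : H) :
  {[{[a, b, c]}, d, e]} = {[{[a, b, e]}, d, c]}.
Proof. by rewrite -!hopA (hopC c). Qed.

Lemma hop_swapm (H : abHeapType) (a b c d e : H) :
  {[{[a, b, c]}, d, e]} = {[{[a, d, c]}, b, e]}.
Proof. by rewrite -!hop_mid (hopC d c b). Qed.

Lemma hop_swap (H : abHeapType) (a b c d e : H) :
  {[{[a, b, c]}, d, e]} = {[{[a, d, e]}, b, c]}.
Proof. by rewrite hop_swapm hop_swapr. Qed.

Lemma hop_medial (H : abHeapType) (a b c d e f g h i : H) :
  {[{[a, b, c]}, {[d, e, f]}, {[g, h, i]}]} =
  {[{[a, d, g]}, {[b, e, h]}, {[c, f, i]}]}.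
Proof.
rewrite !hop_mid !hopA (hop_swap _ f e) (hop_swap a b c).
by rewrite (hop_swapm _ f e) (hop_swap _ b c).
Qed.

End HeapTheory.

(* The truss E(H) of endomorphisms of an Abelian heap. *)
Definition heapEnd (H : abHeapType) : Type := heapMorphism H H.

Section HeapEndTruss.
Variable H : abHeapType.
Implicit Types f g h : heapEnd H.

Fact heapEndP f g : (forall x, heap_fun f x = heap_fun g x) -> f = g.
Proof.
case: f g => [f fP] [g gP] /= fg; have {}fg : f = g by exact: funext.
by case: g / fg gP => gP; rewrite (Prop_irrelevance fP gP).
Qed.

Fact end_hop_subproof f g h (x y z : H) :
  {[heap_fun f {[x, y, z]}, heap_fun g {[x, y, z]}, heap_fun h {[x, y, z]}]} =
  {[{[heap_fun f x, heap_fun g x, heap_fun h x]},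
    {[heap_fun f y, heap_fun g y, heap_fun h y]},
    {[heap_fun f z, heap_fun g z, heap_fun h z]}]}.
Proof. by rewrite !heap_fun_hop hop_medial. Qed.

Definition end_hop f g h : heapEnd H :=
  @HeapMorphism H H (fun x => {[heap_fun f x, heap_fun g x, heap_fun h x]})
    (end_hop_subproof f g h).

Fact end_comp_subproof f g (x y z : H) :
  heap_fun f (heap_fun g {[x, y, z]}) =
  {[heap_fun f (heap_fun g x), heap_fun f (heap_fun g y),
    heap_fun f (heap_fun g z)]}.
Proof. by rewrite !heap_fun_hop. Qed.

Definition end_comp f g : heapEnd H :=
  @HeapMorphism H H (fun x => heap_fun f (heap_fun g x))
    (end_comp_subproof f g).

Fact end_inhabited : inhabited (heapEnd H).
Proof. by exists; exists id. Qed.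

Fact end_hopA f g h k l :
  end_hop f g (end_hop h k l) = end_hop (end_hop f g h) k l.
Proof. by apply: heapEndP => x; exact: hopA. Qed.

Fact end_hopxxy f g : end_hop f f g = g.
Proof. by apply: heapEndP => x; exact: hopxxy. Qed.

Fact end_hopyxx f g : end_hop g f f = g.
Proof. by apply: heapEndP => x; exact: hopyxx. Qed.

HB.instance Definition _ := isHeap.Build (heapEnd H)
  end_inhabited end_hopA end_hopxxy end_hopyxx.

Fact end_hopC f g h : {[f, g, h]} = {[h, g, f]}.
Proof. by apply: heapEndP => x; exact: hopC. Qed.

HB.instance Definition _ := Heap_isAbelian.Build (heapEnd H) end_hopC.

Fact end_compA f g h : end_comp f (end_comp g h) = end_comp (end_comp f g) h.
Proof. exact: heapEndP. Qed.

Fact end_comp_hopr f g h k :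
  end_comp f {[g, h, k]} = {[end_comp f g, end_comp f h, end_comp f k]}.
Proof. by apply: heapEndP => x; exact: heap_fun_hop. Qed.

Fact end_comp_hopl f g h k :
  end_comp {[g, h, k]} f = {[end_comp g f, end_comp h f, end_comp k f]}.
Proof. exact: heapEndP. Qed.

HB.instance Definition _ := AbHeap_isTruss.Build (heapEnd H)
  end_compA end_comp_hopr end_comp_hopl.

End HeapEndTruss.

Record leftModule (T : trussType) := LeftModule {
  lmod_sort :> abHeapType;
  lmod_alpha : trussMorphism T (heapEnd lmod_sort)
}.

Definition lmod_act (T : trussType) (M : leftModule T) (x : T) (m : M) : M :=
  lmod_alpha M x m.

Notation "x |> m" := (lmod_act x m) (at level 40) : truss_scope.

Record lmodMorphism (T : trussType) (M N : leftModule T) := LmodMorphism {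
  lmod_fun :> heapMorphism M N;
  lmod_fun_act : forall (x : T) (m : M), lmod_fun (x |> m) = x |> lmod_fun m
}.

Definition lmod_isomorphic (T : trussType) (M N : leftModule T) : Prop :=
  exists phi : lmodMorphism M N, bijective phi.

(* Main.v *)
Require Import Defs.
From mathcomp Require Import all_boot boolp classical_sets.
Local Open Scope truss_scope.

(* In the Abelian group attached to the heap of [T], the action [λ^e] is
   [e - x e + x p]: the affine map [p |-> x p] recentred so as to fix [e]. The
   translation [p |-> p - e + e'] moves the fixed point from [e] to [e'], so it
   is the isomorphism of (2), with inverse [p |-> p - e' + e]. *)

Section Translation.
Variable H : abHeapType.
Implicit Types a b p : H.

(** The medial law on the right-hand side produces [{[a, a, a]}] and [{[b, b, b]}], which collapse
    to [a] and [b]. *)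
Fact translation_subproof a b (p q r : H) :
  {[{[p, q, r]}, a, b]} = {[{[p, a, b]}, {[q, a, b]}, {[r, a, b]}]}.
Proof. by rewrite hop_medial !hopxxy. Qed.

(** Stated for any Abelian heap, so that it applies to [P] itself, where closure of the sub-heap
    keeps the translate inside [P]. *)
Definition translation a b : heapMorphism H H :=
  @HeapMorphism H H (fun p => {[p, a, b]}) (translation_subproof a b).

Lemma translationK a b : cancel (translation a b) (translation b a).
Proof. by move=> p /=; rewrite -hopA hopxxy hopyxx. Qed.

End Translation.

Section ParagonAction.
Variables (T : trussType) (P : leftParagon T).
Implicit Types (e p : P) (x : T).

(** This is the paragon condition with [e] in the role of [p']. *)
Fact paragon_act_subproof e x p :
  {[val e, x * val e, x * val p]} \in (P : set T).
Proof. by apply/mem_set/paragonP; apply: set_mem; exact: valP. Qed.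

Definition paragon_act e x p : P :=
  exist _ {[val e, x * val e, x * val p]} (paragon_act_subproof e x p).

Fact paragon_act_hop e x p q r :
  paragon_act e x {[p, q, r]} =
  {[paragon_act e x p, paragon_act e x q, paragon_act e x r]}.
Proof. by apply: val_inj; rewrite /= tmul_hopr hop_medial !hopxxy. Qed.

Definition paragon_end e x : heapEnd P :=
  @HeapMorphism P P (paragon_act e x) (paragon_act_hop e x).

Fact paragon_end_hop e (x y z : T) :
  paragon_end e {[x, y, z]} =
  {[paragon_end e x, paragon_end e y, paragon_end e z]}.
Proof.
apply: heapEndP => p; apply: val_inj.
by rewrite /= !tmul_hopl hop_medial hopxxy.
Qed.

(** Distributing [x] over the inner bracket creates a second [x * e], which cancels the one from the
    outer recentring. *)
Fact paragon_end_mul e (x y : T) :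
  paragon_end e (x * y) = paragon_end e x * paragon_end e y.
Proof.
apply: heapEndP => p; apply: val_inj.
by rewrite /= tmul_hopr hopA hopyxx !tmulA.
Qed.

Definition paragon_alpha e : trussMorphism T (heapEnd P) :=
  @TrussMorphism T (heapEnd P)
    (@HeapMorphism T (heapEnd P) (paragon_end e) (paragon_end_hop e))
    (paragon_end_mul e).

Lemma translation_act e e' x p :
  translation P e e' (paragon_act e x p) =
  paragon_act e' x (translation P e e' p).
Proof.
apply: val_inj => /=.
(* Both sides equal [{[e', x * e, x * p]}]: on the right the two copies of [x * e'] cancel, and on
   the left, in the next line, the two copies of [e]. *)
rewrite tmul_hopr (hopC (x * val p)) hopA hopyxx.
by rewrite hop_swapm hopxxy hopC.
Qed.

End ParagonAction.

Theorem proposition4p18 (T : trussType) (P : leftParagon T) :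
  exists alpha : P -> trussMorphism T (heapEnd P),
    (forall (e : P) (x : T) (p : P),
       val (alpha e x p) = {[val e, x * val e, x * val p]}) /\
    (forall e e' : P,
       lmod_isomorphic (LeftModule (alpha e)) (LeftModule (alpha e'))).
Proof.
exists (paragon_alpha T P); split=> [//|e e'].
exists (@LmodMorphism T (LeftModule (paragon_alpha T P e))
  (LeftModule (paragon_alpha T P e')) (translation P e e')
  (translation_act T P e e')).
by exists (translation P e' e); apply: translationK.
Qed.
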